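(* Let $E$ be a neural-symbolic energy function with symbolic component $g_{sy}$ and neural component $\mathbf{g}_{nn}$, and let $f:\mathbb{R}\times\mathcal{Y}\times\{\mathcal{S}_i\}\to\mathbb{R}$ be an objective function. Consider the weights $\mathbf{w}_{sy}\in\mathcal{W}_{sy}$ and $\mathbf{w}_{nn}\in\mathcal{W}_{nn}$ and the training sample $\mathcal{S}_i=(\mathbf{t}^i_{\mathcal{Y}},\mathbf{t}^i_{nn},\mathcal{Z}^i_{nn},\mathcal{Z}^i_{\mathcal{Y}},\mathbf{x}^i_{sy},\mathbf{x}^i_{nn})\in\mathcal{S}$. Suppose there exists a minimizer of the objective function $f$, $$\mathbf{y}^*\in\operatorname*{arg\,min}_{\hat{\mathbf{y}}\in\mathcal{Y}} f\big(E(\hat{\mathbf{y}},\mathbf{x}^i_{sy},\mathbf{x}^i_{nn},\mathbf{w}_{sy},\mathbf{w}_{nn}),\hat{\mathbf{y}},\mathcal{S}_i\big),$$ such that $f(E(\mathbf{y}^*,\mathbf{x}^i_{sy},\mathbf{x}^i_{nn},\mathbf{w}_{sy},\mathbf{w}_{nn}),\mathbf{y}^*,\mathcal{S}_i)$ is finite. If the optimal value-function $$V(\mathbf{w}_{sy},\mathbf{w}_{nn},\mathcal{S}_i):=\min_{\hat{\mathbf{y}}\in\mathcal{Y}} f\big(E(\hat{\mathbf{y}},\mathbf{x}^i_{sy},\mathbf{x}^i_{nn},\mathbf{w}_{sy},\mathbf{w}_{nn}),\hat{\mathbf{y}},\mathcal{S}_i\big)=\min_{\hat{\mathbf{y}}\in\mathcal{Y}}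 f\big(g_{sy}(\hat{\mathbf{y}},\mathbf{x}^i_{sy},\mathbf{w}_{sy},\mathbf{g}_{nn}(\mathbf{x}^i_{nn},\mathbf{w}_{nn})),\hat{\mathbf{y}},\mathcal{S}_i\big)$$ is differentiable with respect to the neural weights $\mathbf{w}_{nn}$, then the gradient of $V$ with respect to $\mathbf{w}_{nn}$ is $$\nabla_{\mathbf{w}_{nn}}V(\mathbf{w}_{sy},\mathbf{w}_{nn},\mathcal{S}_i)=\frac{\partial}{\partial 1}f\big(E(\mathbf{y}^*,\mathbf{x}^i_{sy},\mathbf{x}^i_{nn},\mathbf{w}_{sy},\mathbf{w}_{nn}),\mathbf{y}^*,\mathcal{S}_i\big)\cdot\nabla_5E(\mathbf{y}^*,\mathbf{x}^i_{sy},\mathbf{x}^i_{nn},\mathbf{w}_{sy},\mathbf{w}_{nn}),$$ where $\frac{\partial}{\partial 1}f$ is the partial derivative of $f$ with respect to its first argument, and $\nabla_5E$ is the gradient of the energy with respect to its fifth argument with all other arguments fixed. Similarly, if $V$ is differentiable with respect to the symbolic weights $\mathbf{w}_{sy}$, then the gradient of $V$ with respect to $\mathbf{w}_{sy}$ is $$\nabla_{\mathbf{w}_{sy}}V(\mathbf{w}_{sy},\mathbf{w}_{nn},\mathcal{S}_i)=\frac{\partial}{\partial 1}f\big(E(\mathbf{y}^*,\mathbf{x}^i_{sy},\mathbf{x}^i_{nn},\mathbf{w}_{sy},\mathbf{w}_{nn}),\mathbf{y}^*,\mathcal{S}_i\big)\cdot\nabla_4E(\mathbf{y}^*,\mathbf{x}^i_{sy},\mathbf{x}^i_{nn},\mathbf{w}_{sy},\mathbf{w}_{nn}),$$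 where $\nabla_4E$ is the gradient of the energy with respect to its fourth argument with all other arguments fixed.
   Context: Neural-symbolic energy functions. Let $\mathcal{Y}$ be the domain of target variables, $\mathcal{X}_{sy}$ and $\mathcal{X}_{nn}$ the domains of symbolic and neural inputs, and $\mathcal{W}_{sy}$ and $\mathcal{W}_{nn}$ the domains of symbolic and neural weights. A neural component is a function $\mathbf{g}_{nn}:\mathcal{X}_{nn}\times\mathcal{W}_{nn}\to\mathbb{R}^{d_{nn}}$, a symbolic component is a function $g_{sy}:\mathcal{Y}\times\mathcal{X}_{sy}\times\mathcal{W}_{sy}\times\mathbb{R}^{d_{nn}}\to\mathbb{R}$, and the neural-symbolic energy function is $$E:\mathcal{Y}\times\mathcal{X}_{sy}\times\mathcal{X}_{nn}\times\mathcal{W}_{sy}\times\mathcal{W}_{nn}\to\mathbb{R},\qquad E(\mathbf{y},\mathbf{x}_{sy},\mathbf{x}_{nn},\mathbf{w}_{sy},\mathbf{w}_{nn})=g_{sy}(\mathbf{y},\mathbf{x}_{sy},\mathbf{w}_{sy},\mathbf{g}_{nn}(\mathbf{x}_{nn},\mathbf{w}_{nn})).$$ The target domain and the energy function are otherwise arbitrary. The training dataset $\mathcal{S}$ is a finite collection of samples. A sample $\mathcal{S}_i$ is a tuple consisting of target labels $\mathbf{t}^i_{\mathcal{Y}}$, neural labels $\mathbf{t}^i_{nn}$, neural and symbolic latent-variable domains $\mathcal{Z}^i_{nn},\mathcal{Z}^i_{\mathcal{Y}}$, and inputs $\mathbf{x}^i_{sy}\in\mathcal{X}_{sy}$, $\mathbf{x}^i_{nn}\in\mathcal{X}_{nn}$.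 The objective $f$ maps a compatibility score (an energy value), target variables, and the training sample to a scalar.
   Formalization: The formal statement also assumes that the partial derivative of f in its first argument and the relevant gradient of E exist at the given point for y*, and takes differentiability of V to mean at a weight interior to its domain; without these the formula can be undefined or false. *)

(* Defs.v *)
From HB Require Import structures.
From mathcomp Require Import all_boot all_order all_algebra.
From mathcomp Require Import all_classical all_reals all_analysis.
Import Order.TTheory GRing.Theory Num.Theory.
Import numFieldNormedType.Exports.

Set Implicit Arguments.
Unset Strict Implicit.
Unset Printing Implicit Defensive.

Local Open Scope classical_set_scope.
Local Open Scope ring_scope.

Definition energy (R : realType) (Y Xsy Xnn Wsy Wnn : Type) (dnn : nat)
    (gsy : Y -> Xsy -> Wsy -> 'rV[R]_dnn -> R)
    (gnn : Xnn -> Wnn -> 'rV[R]_dnn)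
    (y : Y) (xsy : Xsy) (xnn : Xnn) (wsy : Wsy) (wnn : Wnn) : R :=
  gsy y xsy wsy (gnn xnn wnn).

(* [TY], [Tnn] are the types of target and neural labels; the latent-variable
   domains are subsets, varying with the sample, of [LY] and [Lnn]. *)
Record sample (TY Tnn LY Lnn Xsy Xnn : Type) := Sample {
  target_labels : TY ;
  neural_labels : Tnn ;
  neural_latent_domain : set Lnn ;
  target_latent_domain : set LY ;
  symbolic_input : Xsy ;
  neural_input : Xnn }.

Definition argmin (R : realType) (Y : Type) (F : Y -> R) : set Y :=
  [set y | forall y', F y <= F y'].

(* The minimum of [F] whenever it is attained (see [minimum_argmin]). Taking
   values in the extended reals, it has no arbitrary value when [F] is
   unbounded below. *)
Definition minimum (R : realType) (Y : Type) (F : Y -> R) : \bar R :=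
  ereal_inf [set (F y)%:E | y in [set: Y]].

Lemma minimum_argmin (R : realType) (Y : Type) (F : Y -> R) (y : Y) :
  argmin F y -> minimum F = (F y)%:E.
Proof.
move=> Fy; apply/eqP; rewrite eq_le; apply/andP; split.
  by apply: ereal_inf_lbound; exists y.
by apply: le_ereal_inf_tmp => _ [z _ <-]; rewrite lee_fin; exact: Fy.
Qed.

Definition sample_objective (R : realType) (Y Wsy Wnn : Type)
    (TY Tnn LY Lnn Xsy Xnn : Type)
    (E : Y -> Xsy -> Xnn -> Wsy -> Wnn -> R)
    (f : R -> Y -> sample TY Tnn LY Lnn Xsy Xnn -> R)
    (wsy : Wsy) (wnn : Wnn) (Si : sample TY Tnn LY Lnn Xsy Xnn) (y : Y) : R :=
  f (E y (symbolic_input Si) (neural_input Si) wsy wnn) y Si.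

Definition value_function (R : realType) (Y Wsy Wnn : Type)
    (TY Tnn LY Lnn Xsy Xnn : Type)
    (E : Y -> Xsy -> Xnn -> Wsy -> Wnn -> R)
    (f : R -> Y -> sample TY Tnn LY Lnn Xsy Xnn -> R)
    (wsy : Wsy) (wnn : Wnn) (Si : sample TY Tnn LY Lnn Xsy Xnn) : \bar R :=
  minimum (sample_objective E f wsy wnn Si).

(* The vector of partial derivatives; meaningful only under [has_gradient]. *)
Definition gradient (R : realType) (n : nat) (F : 'rV[R]_n -> R)
    (w : 'rV[R]_n) : 'rV[R]_n :=
  \row_j 'D_(delta_mx 0 j) F w.

Definition has_gradient (R : realType) (n : nat) (F : 'rV[R]_n -> R)
    (w : 'rV[R]_n) : Prop :=
  forall j : 'I_n, derivable F w (delta_mx 0 j).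

(* Differentiability at [w] of an extended-real-valued function whose domain
   is [D]: [w] is interior to [D], and [G] is finite around [w]. *)
Definition differentiable_in (R : realType) (n : nat) (D : set 'rV[R]_n)
    (G : 'rV[R]_n -> \bar R) (w : 'rV[R]_n) : Prop :=
  [/\ nbhs w D, (\forall u \near w, G u \is a fin_num) &
      differentiable (fine \o G) w].

(* Main.v *)
(* For a fixed minimizer [ystar], the function w |-> f(E(ystar, w), ystar) lies
   above the value function and touches it at the given weights, so their
   difference has a local minimum there and its partial derivatives vanish. The
   chain rule computes those of the upper function. *)
Require Import Defs.
From HB Require Import structures.
From mathcomp Require Import all_boot all_order all_algebra.
From mathcomp Require Import all_classical all_reals all_analysis.
Import Order.TTheory GRing.Theory Num.Theory.
Import numFieldNormedType.Exports.

Set Implicit Arguments.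
Unset Strict Implicit.
Unset Printing Implicit Defensive.

Local Open Scope classical_set_scope.
Local Open Scope ring_scope.

(** Near the minimum the increment of [f] along [v] is nonnegative, so the difference quotient has
    the sign of [h]. The left limit is thus at most 0, the right limit at least 0, and both equal
    the derivative. *)
Lemma derive_local_min (R : realType) (V : normedModType R) (f : V -> R)
    (x v : V) :
  derivable f x v -> (\forall u \near x, f x <= f u) -> 'D_v f x = 0.
Proof.
move=> df fmin.
have lmin : \forall h \near (0 : R), f x <= f (h *: v + x).
  suff : h *: v + x @[h --> (0 : R)] --> x by move/(_ _ fmin).
  rewrite -[X in _ --> X]add0r -[X in X + _](scale0r v).
  by apply: cvgD; [apply: cvgZr_tmp; exact: cvg_id|exact: cvg_cst].
apply/eqP; rewrite eq_le; apply/andP; split.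
  rewrite /derive cvg_at_leftE//; apply: limr_le.
    exact: (cvgP _ (cvg_dnbhs_at_left df)).
  near=> h; apply: mulr_le0_ge0.
    by rewrite invr_le0 ltW//; near: h; exact: nbhs_left_lt.
  rewrite subr_ge0 /=; near: h; exact: (cvg_within _ lmin).
rewrite /derive cvg_at_rightE//; apply: limr_ge.
  exact: (cvgP _ (cvg_dnbhs_at_right df)).
near=> h; apply: mulr_ge0.
  by rewrite invr_ge0 ltW//; near: h; exact: nbhs_right_gt.
rewrite subr_ge0 /=; near: h; exact: (cvg_within _ lmin).
Unshelve. all: by end_near. Qed.

Lemma derive_line (R : realType) (V : normedModType R) (f : V -> R) (x v : V) :
  'D_v f x = derive1 (fun h : R => f (h *: v + x)) 0.
Proof.
rewrite derive1E /derive; set g1 := fun h => h^-1 *: _.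
set g2 := fun h => h^-1 *: _; suff -> : g1 = g2 by [].
by apply/funext => h; rewrite /g1 /g2 /= addr0 scale0r add0r [_%:A]mulr1.
Qed.

(** On the line [h *: v + x] both maps have a real argument, where derivability is
    differentiability; a derivative of [e] along [v] alone therefore suffices. *)
Lemma is_derive_chain (R : realType) (V : normedModType R) (phi : R -> R)
    (e : V -> R) (x v : V) :
  derivable phi (e x) 1 -> derivable e x v ->
  is_derive x v (phi \o e) (derive1 phi (e x) * 'D_v e x).
Proof.
move=> dphi de; have /derivable1P de0 := de.
(* The one-variable chain rule is applied at [h = 0], where the base point appears as
   [0 *: v + x]. *)
have dphi0 : derivable phi (e (0 *: v + x)) 1 by rewrite scale0r add0r.
apply: DeriveDef.
  apply/derivable1P/derivable1_diffP.
  by apply: (@differentiable_comp _ _ _ _ (fun h : R => e (h *: v + x)));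
    exact/derivable1_diffP.
rewrite [LHS]derive_line (derive_line e).
have := @derive1_comp _ (fun h : R => e (h *: v + x)) phi 0 de0 dphi0.
by rewrite scale0r add0r.
Qed.

Lemma gradient_lower_envelope (R : realType) (n : nat) (D : set 'rV[R]_n)
    (G : 'rV[R]_n -> \bar R) (phi : R -> R) (e : 'rV[R]_n -> R)
    (w : 'rV[R]_n) :
  (forall u, (G u <= (phi (e u))%:E)%E) -> G w = (phi (e w))%:E ->
  derivable phi (e w) 1 -> differentiable_in D G w -> has_gradient e w ->
  gradient (fun u => fine (G u)) w = derive1 phi (e w) *: gradient e w.
Proof.
move=> Gle Gw dphi [_ Gfin dG] de; apply/rowP => j; rewrite !mxE.
have dGj : derivable (fine \o G) w (delta_mx 0 j) by exact: diff_derivable.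
have [dpe <-] := is_derive_chain dphi (de j).
apply/esym/eqP; rewrite -subr_eq0 -deriveB//; apply/eqP.
apply: derive_local_min; first exact: derivableB.
(* The difference vanishes at [w] by contact, so the minimum amounts to its nonnegativity nearby. *)
near=> u; rewrite /= !fctE /= Gw /= subrr subr_ge0.
(* Finiteness of [G] near [w] matters here: [fine] sends [-oo] to 0, which could exceed
   [phi (e u)]. *)
rewrite -lee_fin fineK; first exact: Gle.
by near: u.
Unshelve. all: by end_near. Qed.

(* The weight domains are the subsets Wsy and Wnn of Euclidean spaces; the
   values of gsy and gnn at weights outside of them are irrelevant. *)
Theorem mainTheorem2 (R : realType) (Y Xsy Xnn TY Tnn LY Lnn : Type)
    (msy mnn dnn : nat) (Wsy : set 'rV[R]_msy) (Wnn : set 'rV[R]_mnn)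
    (gsy : Y -> Xsy -> 'rV[R]_msy -> 'rV[R]_dnn -> R)
    (gnn : Xnn -> 'rV[R]_mnn -> 'rV[R]_dnn)
    (P : nat) (S : 'I_P -> sample TY Tnn LY Lnn Xsy Xnn)
    (f : R -> Y -> sample TY Tnn LY Lnn Xsy Xnn -> R)
    (wsy : 'rV[R]_msy) (wsy_in : Wsy wsy)
    (wnn : 'rV[R]_mnn) (wnn_in : Wnn wnn)
    (i : 'I_P) (ystar : Y) :
  let E := energy gsy gnn in
  let xsy := symbolic_input (S i) in
  let xnn := neural_input (S i) in
  let V := value_function E f in
  let estar := E ystar xsy xnn wsy wnn in
  argmin (fun y => f (E y xsy xnn wsy wnn) y (S i)) ystar ->
  derivable (fun e : R => f e ystar (S i)) estar 1 ->
  (differentiable_in Wnn (fun w => V wsy w (S i)) wnn ->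
   has_gradient (fun w => E ystar xsy xnn wsy w) wnn ->
   gradient (fun w => fine (V wsy w (S i))) wnn =
     derive1 (fun e : R => f e ystar (S i)) estar *:
       gradient (fun w => E ystar xsy xnn wsy w) wnn) /\
  (differentiable_in Wsy (fun w => V w wnn (S i)) wsy ->
   has_gradient (fun w => E ystar xsy xnn w wnn) wsy ->
   gradient (fun w => fine (V w wnn (S i))) wsy =
     derive1 (fun e : R => f e ystar (S i)) estar *:
       gradient (fun w => E ystar xsy xnn w wnn) wsy).
Proof.
move=> E xsy xnn V estar ymin df.
(* [ystar] remains a competitor at all weights [a], [b], although it may stop being a minimizer
   there. *)
have Vle a b : (V a b (S i) <= (f (E ystar xsy xnn a b) ystar (S i))%:E)%E.
  by apply: ereal_inf_lbound; exists ystar.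
have Vw : V wsy wnn (S i) = (f estar ystar (S i))%:E by exact: minimum_argmin.
split=> dV dE.
  exact: (@gradient_lower_envelope _ _ Wnn _ (fun e => f e ystar (S i))
    (fun w => E ystar xsy xnn wsy w) wnn (Vle wsy) Vw df dV dE).
exact: (@gradient_lower_envelope _ _ Wsy _ (fun e => f e ystar (S i))
  (fun w => E ystar xsy xnn w wnn) wsy (Vle^~ wnn) Vw df dV dE).
Qed.
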